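(* Let $\Sigma=(A,B,C,D;\mathcal X,\mathcal U,\mathcal Y)$ be a linear discrete time-invariant system and let $H\in\mathrm{RI}_\Sigma$. Then the system $\Sigma$ is $H$-passive, i.e. the system matrix $M(\Sigma_H)$ is a contraction. Furthermore, $H\in\mathrm{RE}_\Sigma$ if and only if $$\inf\left\{\left\|\begin{bmatrix}x\\ u\end{bmatrix}\right\|^2-\left\|M(\Sigma_H)\begin{bmatrix}x\\ u\end{bmatrix}\right\|^2\ \Big|\ u\in\mathcal U\right\}=0\qquad\text{for every }x\in\mathcal X .$$
   Context: A system $\Sigma=(A,B,C,D;\mathcal X,\mathcal U,\mathcal Y)$ is the discrete time-invariant linear system $x_{n+1}=Ax_n+Bu_n$, $y_n=Cx_n+Du_n$ $(n\ge 0)$, where $A:\mathcal X\to\mathcal X$, $B:\mathcal U\to\mathcal X$, $C:\mathcal X\to\mathcal Y$, $D:\mathcal U\to\mathcal Y$ are bounded linear operators between separable (complex) Hilbert spaces. Its system matrix is $M(\Sigma)=\begin{bmatrix}A&B\\C&D\end{bmatrix}:\mathcal X\oplus\mathcal U\to\mathcal X\oplus\mathcal Y$. The system is passive (with respect to the scattering supply rate) if $M(\Sigma)$ is a contraction, i.e. has norm at most one. For a bounded selfadjoint operator $T$ on a Hilbert space $\mathcal H$, put $\mathcal H_1=\overline{T\mathcal H}$, $\mathcal H_2=\operatorname{Ker}T=\mathcal H\ominus\mathcal H_1$, $T_1=T|_{\mathcal H_1}$ (injective on $\mathcal H_1$). The Moore--Penrose pseudo-inverse $T^{[-1]}$ is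 the (possibly unbounded) selfadjoint operator with domain $\operatorname{Im}T_1\oplus\mathcal H_2$ acting as $T_1^{-1}$ on $\operatorname{Im}T_1$ and as $0$ on $\mathcal H_2$. $\mathcal D(\cdot)$ denotes the domain of an operator. $\mathrm{RI}_\Sigma$ is the set of all (possibly unbounded) selfadjoint operators $H$ in $\mathcal X$ such that: (1) $\langle Hx,x\rangle>0$ for each $0\ne x\in\mathcal D(H)$; (2) $A\mathcal D(H^{1/2})\subset\mathcal D(H^{1/2})$ and $B\mathcal U\subset\mathcal D(H^{1/2})$ (so $H^{1/2}B:\mathcal U\to\mathcal X$ is bounded); (3) the operator $\delta_\Sigma(H)=I_{\mathcal U}-D^*D-(H^{1/2}B)^*H^{1/2}B$ is bounded and nonnegative, and $\big(D^*C+(H^{1/2}B)^*H^{1/2}A\big)\mathcal D(H^{1/2})\subset\delta_\Sigma(H)^{1/2}\mathcal U$; (4) for each $x\in\mathcal D(H^{1/2})$, $$\|H^{1/2}x\|^2-\|H^{1/2}Ax\|^2-\|Cx\|^2\ \ge\ \big\|\big(\delta_\Sigma(H)^{1/2}\big)^{[-1]}\big(D^*C+(H^{1/2}B)^*H^{1/2}A\big)x\big\|^2 .$$ $\mathrm{RE}_\Sigma$ is the subset of those $H\in\mathrm{RI}_\Sigma$ for which equality holds in (4) for every $x\in\mathcal D(H^{1/2})$. For $H\in\mathrm{RI}_\Sigma$ the system associated with $\Sigma$ and $H$ is $\Sigma_H=(A_H,B_H,C_H,D;\mathcal X,\mathcal U,\mathcal Y)$, where $B_H=H^{1/2}B$ and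 $A_H:\mathcal X\to\mathcal X$, $C_H:\mathcal X\to\mathcal Y$ are the unique bounded operators (contractions) determined by $A_HH^{1/2}x=H^{1/2}Ax$ and $C_HH^{1/2}x=Cx$ for $x\in\mathcal D(H^{1/2})$ (these formulas define contractions on the dense subspace $\operatorname{Im}H^{1/2}$, which are extended by continuity). $\Sigma$ is called $H$-passive when $\Sigma_H$ is passive. *)

(* Defs.v *)
From mathcomp Require Import all_boot all_order all_algebra sesquilinear.
From mathcomp Require Import complex.
From mathcomp Require Import all_classical all_reals all_analysis.
Set Implicit Arguments.
Unset Strict Implicit.
Unset Printing Implicit Defensive.
Import Order.TTheory GRing.Theory Num.Theory.
Import numFieldNormedType.Exports.
Local Open Scope classical_set_scope.
Local Open Scope complex_scope.
Local Open Scope ring_scope.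

(* Separable complex Hilbert spaces; [inner] is linear in its first argument
   and conjugate-linear in its second one. *)
Record hilbert (R : realType) := Hilbert {
  hilbert_space :> completeNormedModType R[i];
  inner : {dot hilbert_space for Num.conj};
  norm_inner : forall x : hilbert_space, `|x| ^+ 2 = inner x x;
  hilbert_separable :
    exists2 E : set hilbert_space, countable E & dense E }.

(* The norm of a normed module over R[i] takes its values in R[i]. *)
Definition hnorm (R : realType) (X : hilbert R) (x : X) : R := complex.Re `|x|.

Record bounded_op (R : realType) (X Y : hilbert R) := BoundedOp {
  bounded_fun :> {linear X -> Y};
  bounded_funP :
    exists M : R, forall x, hnorm (bounded_fun x) <= M * hnorm x }.

(* The values of [pfun T] outside [dom T] are irrelevant; sums, products and
   adjoints below have their natural (maximal) domains. *)
Record partial_op (R : realType) (X Y : hilbert R) := PartialOp {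
  dom : set X;
  pfun :> X -> Y }.

Definition op_eq (R : realType) (X Y : hilbert R) (S T : partial_op X Y) :=
  dom S = dom T /\ forall x, dom S x -> S x = T x.

Definition total (R : realType) (X Y : hilbert R) (T : bounded_op X Y) :
  partial_op X Y := PartialOp setT T.

Definition op_id (R : realType) (X : hilbert R) : partial_op X X :=
  PartialOp setT id.

Definition op_add (R : realType) (X Y : hilbert R) (S T : partial_op X Y) :
    partial_op X Y :=
  PartialOp (dom S `&` dom T) (fun x => S x + T x).

Definition op_sub (R : realType) (X Y : hilbert R) (S T : partial_op X Y) :
    partial_op X Y :=
  PartialOp (dom S `&` dom T) (fun x => S x - T x).

Definition op_comp (R : realType) (X Y Z : hilbert R)
    (S : partial_op Y Z) (T : partial_op X Y) : partial_op X Z :=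
  PartialOp [set x | dom T x /\ dom S (T x)] (fun x => S (T x)).

Definition op_range (R : realType) (X Y : hilbert R) (T : partial_op X Y) :
  set Y := T @` dom T.

Definition maps_into (R : realType) (X Y : hilbert R) (T : partial_op X Y)
    (E : set X) (F : set Y) :=
  forall x, E x -> dom T x /\ F (T x).

Definition linear_op (R : realType) (X Y : hilbert R) (T : partial_op X Y) :=
  dom T 0 /\
  forall (a : R[i]) (x y : X), dom T x -> dom T y ->
    dom T (a *: x + y) /\ T (a *: x + y) = a *: T x + T y.

Definition is_bounded (R : realType) (X Y : hilbert R) (T : partial_op X Y) :=
  dom T = setT /\ exists M : R, forall x, hnorm (T x) <= M * hnorm x.

Definition nonneg_op (R : realType) (X : hilbert R) (T : partial_op X X) :=
  forall x, dom T x -> 0 <= inner X (T x) x.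

Definition adjoint_spec (R : realType) (X Y : hilbert R) (T : partial_op X Y)
    (y : Y) (z : X) :=
  forall x, dom T x -> inner Y (T x) y = inner X x z.

Definition adjoint (R : realType) (X Y : hilbert R) (T : partial_op X Y) :
    partial_op Y X :=
  PartialOp [set y | exists z, adjoint_spec T y z]
            (fun y => xget 0 [set z | adjoint_spec T y z]).

Definition selfadjoint (R : realType) (X : hilbert R) (T : partial_op X X) :=
  [/\ linear_op T, dense (dom T) & op_eq (adjoint T) T].

Definition is_sqrt (R : realType) (X : hilbert R) (T S : partial_op X X) :=
  [/\ selfadjoint S, nonneg_op S & op_eq (op_comp S S) T].

(* The square root of a nonnegative selfadjoint operator is its only
   nonnegative selfadjoint root; operators that have no such root are sent to
   themselves. *)
Definition op_sqrt (R : realType) (X : hilbert R) (T : partial_op X X) :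
    partial_op X X :=
  match pselect (exists S, is_sqrt T S) with
  | left e => projT1 (cid e)
  | right _ => T
  end.

(* [mp_spec T y x] means y = T_1 x + z with x in the domain of the restriction
   T_1 of T to the closure of its range, and z in the kernel of T. *)
Definition mp_spec (R : realType) (X : hilbert R) (T : partial_op X X)
    (y x : X) :=
  [/\ dom T x, closure (op_range T) x &
      exists z, [/\ dom T z, T z = 0 & y = T x + z]].

Definition mp_inverse (R : realType) (X : hilbert R) (T : partial_op X X) :
    partial_op X X :=
  PartialOp [set y | exists x, mp_spec T y x]
            (fun y => xget 0 [set x | mp_spec T y x]).

Record system (R : realType) (X U Y : hilbert R) := System {
  sysA : bounded_op X X;
  sysB : bounded_op U X;
  sysC : bounded_op X Y;
  sysD : bounded_op U Y }.

(* Norm of the Hilbert direct sum; the norm that the library puts on a product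
   type is the maximum of the norms of the components. *)
Definition dsum_norm (R : realType) (X U : hilbert R) (p : X * U) : R :=
  Num.sqrt (hnorm p.1 ^+ 2 + hnorm p.2 ^+ 2).

Definition system_matrix (R : realType) (X U Y : hilbert R)
    (Sig : system X U Y) (p : X * U) : X * Y :=
  (sysA Sig p.1 + sysB Sig p.2, sysC Sig p.1 + sysD Sig p.2).

Definition passive (R : realType) (X U Y : hilbert R) (Sig : system X U Y) :=
  forall p : X * U, dsum_norm (system_matrix Sig p) <= dsum_norm p.

Definition sqrtB (R : realType) (X U Y : hilbert R) (Sig : system X U Y)
    (H : partial_op X X) : partial_op U X :=
  op_comp (op_sqrt H) (total (sysB Sig)).

Definition delta (R : realType) (X U Y : hilbert R) (Sig : system X U Y)
    (H : partial_op X X) : partial_op U U :=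
  op_sub
    (op_sub (op_id U)
            (op_comp (adjoint (total (sysD Sig))) (total (sysD Sig))))
    (op_comp (adjoint (sqrtB Sig H)) (sqrtB Sig H)).

Definition cross_op (R : realType) (X U Y : hilbert R) (Sig : system X U Y)
    (H : partial_op X X) : partial_op X U :=
  op_add
    (op_comp (adjoint (total (sysD Sig))) (total (sysC Sig)))
    (op_comp (adjoint (sqrtB Sig H))
             (op_comp (op_sqrt H) (total (sysA Sig)))).

Definition kyp_lhs (R : realType) (X U Y : hilbert R) (Sig : system X U Y)
    (H : partial_op X X) (x : X) : R :=
  hnorm (op_sqrt H x) ^+ 2 - hnorm (op_sqrt H (sysA Sig x)) ^+ 2
  - hnorm (sysC Sig x) ^+ 2.

Definition kyp_rhs (R : realType) (X U Y : hilbert R) (Sig : system X U Y)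
    (H : partial_op X X) (x : X) : R :=
  hnorm (mp_inverse (op_sqrt (delta Sig H)) (cross_op Sig H x)) ^+ 2.

Record RI (R : realType) (X U Y : hilbert R) (Sig : system X U Y)
    (H : partial_op X X) : Prop := {
  RI_selfadjoint : selfadjoint H;
  RI_positive : forall x, dom H x -> x != 0 -> 0 < inner X (H x) x;
  RI_A : maps_into (total (sysA Sig)) (dom (op_sqrt H)) (dom (op_sqrt H));
  RI_B : maps_into (total (sysB Sig)) setT (dom (op_sqrt H));
  RI_delta_bounded : is_bounded (delta Sig H);
  RI_delta_nonneg : nonneg_op (delta Sig H);
  RI_cross : maps_into (cross_op Sig H) (dom (op_sqrt H))
               (op_range (op_sqrt (delta Sig H)));
  RI_kyp : forall x, dom (op_sqrt H) x -> kyp_rhs Sig H x <= kyp_lhs Sig H x }.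

Definition RE (R : realType) (X U Y : hilbert R) (Sig : system X U Y)
    (H : partial_op X X) : Prop :=
  RI Sig H /\
  forall x, dom (op_sqrt H) x -> kyp_lhs Sig H x = kyp_rhs Sig H x.

Record associated (R : realType) (X U Y : hilbert R) (Sig : system X U Y)
    (H : partial_op X X) (SigH : system X U Y) : Prop := {
  associatedA : forall x, dom (op_sqrt H) x ->
    sysA SigH (op_sqrt H x) = op_sqrt H (sysA Sig x);
  associatedB : forall u, sysB SigH u = op_sqrt H (sysB Sig u);
  associatedC : forall x, dom (op_sqrt H) x ->
    sysC SigH (op_sqrt H x) = sysC Sig x;
  associatedD : sysD SigH = sysD Sig }.

(* For H in [RI Sig] the associated system exists and is unique; the default
   value is never used for such H. *)
Definition assoc_system (R : realType) (X U Y : hilbert R)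
    (Sig : system X U Y) (H : partial_op X X) : system X U Y :=
  match pselect (exists SigH, associated Sig H SigH) with
  | left e => projT1 (cid e)
  | right _ => Sig
  end.

Definition H_passive (R : realType) (X U Y : hilbert R) (Sig : system X U Y)
    (H : partial_op X X) :=
  passive (assoc_system Sig H).

(* Main.v *)
(** Completing the square. Let [S] be the square root of [H], [Q] that of
    [delta], and let [w] be the image of the cross term at [x] under the
    pseudo-inverse of [Q]. For [x] in the domain of [S] and [G] the associated
    system,
    [|(S x, u)|^2 - |M(G) (S x, u)|^2 = (kyp_lhs x - kyp_rhs x) + |w - Q u|^2].
    The range of [S] is dense since [S] is selfadjoint and injective, so
    passivity follows by continuity. As [w] lies in the closure of the range of
    [Q], the infimum over [u] equals [kyp_lhs x - kyp_rhs x]; its vanishing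
    passes from the range of [S] to the whole space because the left-hand side
    is a nonnegative quadratic form, hence satisfies
    [q (a + b) <= 2 q a + 2 q b]. *)
From HB Require Import structures.
Require Import Defs.
From mathcomp Require Import all_boot all_order all_algebra sesquilinear.
From mathcomp Require Import complex lra ring.
From mathcomp Require Import all_classical all_reals all_analysis.
Set Implicit Arguments.
Unset Strict Implicit.
Unset Printing Implicit Defensive.
Import Order.TTheory GRing.Theory Num.Theory.
Import numFieldNormedType.Exports.
Local Open Scope complex_scope.
Local Open Scope classical_set_scope.
Local Open Scope ring_scope.

(** * Real part of the inner product, real-valued norm, completeness and closure *)

Definition rin (R : realType) (X : hilbert R) (x y : X) : R :=
  complex.Re (inner X x y).

Section RealInner.
Context {R : realType} {X : hilbert R}.
Implicit Types (x y z : X) (a : R) (c : R[i]).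

Lemma innerDl x y z : inner X (x + y) z = inner X x z + inner X y z.
Proof. exact: linearDl. Qed.

Lemma innerZl c x y : inner X (c *: x) y = c * inner X x y.
Proof. exact: linearZl_LR. Qed.

Lemma innerC x y : inner X x y = (inner X y x)^*.
Proof. by rewrite hermC expr0 mul1r. Qed.

Lemma rinC x y : rin x y = rin y x.
Proof. by rewrite /rin innerC; case: (inner X y x). Qed.

Lemma rinDl x y z : rin (x + y) z = rin x z + rin y z.
Proof. by rewrite /rin innerDl raddfD. Qed.

Lemma rinZl a x y : rin (a%:C *: x) y = a * rin x y.
Proof.
by rewrite /rin innerZl; case: (inner X x y) => u v /=; rewrite mul0r subr0.
Qed.

Lemma rinNl x y : rin (- x) y = - rin x y.
Proof. by rewrite /rin -scaleN1r innerZl mulN1r raddfN. Qed.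

Lemma rinDr x y z : rin x (y + z) = rin x y + rin x z.
Proof. by rewrite rinC rinDl !(rinC x). Qed.

Lemma rinZr a x y : rin x (a%:C *: y) = a * rin x y.
Proof. by rewrite rinC rinZl rinC. Qed.

Lemma rinNr x y : rin x (- y) = - rin x y.
Proof. by rewrite rinC rinNl rinC. Qed.

Lemma rin0l x : rin 0 x = 0.
Proof. by rewrite -(subrr x) rinDl rinNl subrr. Qed.

Lemma rin0r x : rin x 0 = 0.
Proof. by rewrite rinC rin0l. Qed.

Lemma rin_Im x y : complex.Im (inner X x y) = rin x ('i%C *: y).
Proof.
rewrite rinC /rin innerZl (innerC x y); case: (inner X y x) => u v /=.
by rewrite mul0r mul1r sub0r.
Qed.

(** Real parts lose nothing when the second argument may be rescaled: [c = 1] recovers the real part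
    of the inner product and [c = 'i] its imaginary part. *)
Lemma rin_inner_eq x y z t :
  (forall c, rin x (c *: y) = rin z (c *: t)) -> inner X x y = inner X z t.
Proof.
move=> h; have h1 := h 1; rewrite !scale1r in h1.
have h2 := h 'i%C; rewrite -!rin_Im in h2.
move: h1 h2; rewrite /rin.
by case: (inner X x y) (inner X z t) => a b [c d] /= -> ->.
Qed.

Lemma normr_hnorm x : `|x| = (hnorm x)%:C.
Proof. by rewrite /hnorm RRe_real // normr_real. Qed.

Lemma hnorm_ge0 x : 0 <= hnorm x.
Proof. by have := normr_ge0 x; rewrite normr_hnorm ler0c. Qed.

Lemma hnorm_sqr x : hnorm x ^+ 2 = rin x x.
Proof. by rewrite /rin -norm_inner normr_hnorm -rmorphXn. Qed.

Lemma hnorm_eq0 x : hnorm x = 0 -> x = 0.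
Proof. by move=> h; apply/eqP; rewrite -normr_eq0 normr_hnorm h. Qed.

Lemma hnorm0 : hnorm (0 : X) = 0.
Proof. by rewrite /hnorm normr0. Qed.

Lemma hnormN x : hnorm (- x) = hnorm x.
Proof. by rewrite /hnorm normrN. Qed.

Lemma hnormBC x y : hnorm (x - y) = hnorm (y - x).
Proof. by rewrite -hnormN opprB. Qed.

Lemma hnormD x y : hnorm (x + y) <= hnorm x + hnorm y.
Proof. by have := ler_normD x y; rewrite !normr_hnorm -rmorphD lecR. Qed.

Lemma hnormZ c x : hnorm (c *: x) = complex.Re `|c| * hnorm x.
Proof.
rewrite {1}/hnorm normrZ normr_hnorm -{1}(RRe_real (normr_real c)).
by rewrite -rmorphM.
Qed.

Lemma hnormZr a x : 0 <= a -> hnorm (a%:C *: x) = a * hnorm x.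
Proof. by move=> a0; rewrite hnormZ ger0_norm ?ler0c. Qed.

Lemma hnorm_sqrD x y :
  hnorm (x + y) ^+ 2 = hnorm x ^+ 2 + 2 * rin x y + hnorm y ^+ 2.
Proof. rewrite !hnorm_sqr rinDl !rinDr (rinC y x); lra. Qed.

Lemma hnorm_sqrB x y :
  hnorm (x - y) ^+ 2 = hnorm x ^+ 2 - 2 * rin x y + hnorm y ^+ 2.
Proof. rewrite hnorm_sqrD rinNr hnormN; lra. Qed.

Lemma parallelogram x y :
  hnorm (x + y) ^+ 2 + hnorm (x - y) ^+ 2 =
  2 * hnorm x ^+ 2 + 2 * hnorm y ^+ 2.
Proof. rewrite hnorm_sqrB hnorm_sqrD; lra. Qed.

(** A positive element of [R[i]] is a positive real, so completeness, stated with balls of radius in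
    [R[i]], can be used with real radii. *)
Lemma hnorm_cvg_cauchy (u : nat -> X) :
  (forall e : R, 0 < e -> exists N : nat, forall m n, (N <= m)%N -> (N <= n)%N ->
     hnorm (u m - u n) < e) ->
  exists l, forall e : R, 0 < e -> exists N : nat, forall n, (N <= n)%N ->
     hnorm (u n - l) < e.
Proof.
move=> hu.
have : cvg (u @ \oo).
  apply/cauchy_cvgP/cauchy_ballP => e e0.
  have er : e = (complex.Re e)%:C by rewrite RRe_real // gtr0_real.
  have /hu [N hN] : 0 < complex.Re e by rewrite -ltcR -er.
  near_simpl; near=> m n => /=.
  rewrite -ball_normE /ball_ /= normr_hnorm er ltcR.
  by apply: hN; [near: m|near: n]; exists N.
move=> /cvg_ex [l ul]; exists l => e e0.
move/cvgrPdist_lt: ul => /(_ e%:C); rewrite ltcR => /(_ e0) [N _ hN].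
by exists N => n /hN /=; rewrite normr_hnorm ltcR hnormBC.
Unshelve. all: by end_near.
Qed.

Lemma closure_hnormP (E : set X) x :
  closure E x <-> forall e : R, 0 < e -> exists2 y, E y & hnorm (x - y) < e.
Proof.
split=> [+ e e0|h].
  move=> /(_ (ball x e%:C)) [|y [Ey]]; first by apply: nbhsx_ballx; rewrite ltcR.
  by rewrite -ball_normE /ball_ /= normr_hnorm ltcR; exists y.
move=> B /nbhs_ballP [e /= e0 eB].
have er : e = (complex.Re e)%:C by rewrite RRe_real // gtr0_real.
have /h [y Ey xy] : 0 < complex.Re e by rewrite -ltcR -er.
exists y; split => //; apply: eB.
by rewrite -ball_normE /ball_ /= normr_hnorm er ltcR.
Qed.

Lemma dense_closure (E : set X) : dense E <-> forall x, closure E x.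
Proof.
split=> [dE x B|h V [x Vx] openV].
  rewrite nbhsE => -[V [openV Vx] VB].
  have [y [Vy Ey]] := dE V (ex_intro _ x Vx) openV.
  by exists y; split => //; exact: VB.
by rewrite setIC; apply: (h x); apply: open_nbhs_nbhs.
Qed.

End RealInner.

(** * Cauchy-Schwarz inequality and orthogonal projection *)

Lemma discriminant_le0 (R : realType) (a b c : R) : 0 <= c ->
  (forall t, 0 <= a + 2 * t * b + t ^+ 2 * c) -> b ^+ 2 <= a * c.
Proof.
rewrite le_eqVlt eq_sym => /predU1P[-> h|c0 h].
  rewrite mulr0; have [->|b0] := eqVneq b 0; first by rewrite expr0n.
  (* For [c = 0] and [b != 0] the affine expression takes the value [-1] at this point. *)
  have := h (- (a + 1) / (2 * b)); rewrite mulr0 addr0.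
  have -> : a + 2 * (- (a + 1) / (2 * b)) * b = - 1 by field.
  by lra.
(* This is the minimiser of the quadratic polynomial. *)
have := h (- b / c).
have -> : a + 2 * (- b / c) * b + (- b / c) ^+ 2 * c = a - b ^+ 2 / c.
  by field; rewrite gt_eqF.
by rewrite subr_ge0 ler_pdivrMr.
Qed.

Lemma null_sequence (R : realType) :
  exists2 r : nat -> R, (forall n, 0 < r n) &
    forall e, 0 < e -> exists N : nat, forall n, (N <= n)%N -> r n < e.
Proof.
exists (fun n => n.+1%:R^-1) => [n|e e0]; first by rewrite invr_gt0.
exists (Num.truncn e^-1) => n hn.
rewrite invf_plt ?posrE //.
by rewrite (lt_le_trans (truncnS_gt _)) // ler_nat ltnS.
Qed.

Section Projection.
Context {R : realType} {X : hilbert R}.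
Implicit Types (x y z : X) (a e : R) (c : R[i]).

(** The values of the form at [x + t y] are a nonnegative quadratic polynomial in [t]. The identity
    gives the usual inequality; other choices of [T] serve to bound positive operators. *)
Lemma form_cauchy_schwarz (T : {linear X -> X}) :
  (forall x y, rin (T x) y = rin x (T y)) -> (forall x, 0 <= rin (T x) x) ->
  forall x y, rin (T x) y ^+ 2 <= rin (T x) x * rin (T y) y.
Proof.
move=> sym pos x y; apply: discriminant_le0 => // t.
have := pos (x + t%:C *: y).
rewrite linearD linearZ /= rinDl !rinDr !rinZl !rinZr (rinC (T y) x) -sym; lra.
Qed.

Lemma cauchy_schwarz x y : `|rin x y| <= hnorm x * hnorm y.
Proof.
rewrite -(@ler_pXn2r _ 2) // ?nnegrE ?mulr_ge0 ?hnorm_ge0 //.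
rewrite real_normK ?num_real // exprMn !hnorm_sqr.
apply: (form_cauchy_schwarz (T := idfun)) => // z.
by rewrite -hnorm_sqr exprn_ge0 // hnorm_ge0.
Qed.

(* All vectors of [E] that nearly minimise the distance to [w] are close to
   each other, by the parallelogram identity, and [w - v] is nearly orthogonal
   to [E] for each of them. *)
Lemma orthogonal_projection (E : set X) w :
  E 0 -> (forall c x y, E x -> E y -> E (c *: x + y)) ->
  exists x, closure E x /\ forall y, E y -> rin (w - x) y = 0.
Proof.
move=> E0 Elin.
pose D := [set hnorm (w - y) ^+ 2 | y in E].
have Dlb : has_inf D.
  split; first by exists (hnorm (w - 0) ^+ 2), 0.
  by exists 0 => _ [y _ <-]; rewrite exprn_ge0 ?hnorm_ge0.
have Dmin y : E y -> inf D <= hnorm (w - y) ^+ 2.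
  by move=> Ey; apply: ge_inf; [case: Dlb | exists y].
have ED x y : E x -> E y -> E (x + y).
  by move=> Ex Ey; rewrite -[x]scale1r; exact: Elin.
have EZ c x : E x -> E (c *: x).
  by move=> Ex; rewrite -[_ *: _]addr0; exact: Elin.
have [r r0 small] := null_sequence R.
have /choice [v hv] : forall n : nat, exists v, E v /\
    hnorm (w - v) ^+ 2 < inf D + r n.
  move=> n; have /(inf_adherent (E := D))/(_ Dlb) [_ [y Ey <-] hy] :
    0 < r n by [].
  by exists y.
have close m n : hnorm (v m - v n) ^+ 2 < 2 * r m + 2 * r n.
  have [[Em hm] [En hn]] := (hv m, hv n).
  have := parallelogram (w - v m) (w - v n).
  have -> : w - v m - (w - v n) = v n - v m by rewrite opprB addrC addrA subrK.
  have -> : w - v m + (w - v n) = (2 : R)%:C *: (w - (2^-1 : R)%:C *: (v m + v n)).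
    rewrite scalerBr scalerA -rmorphM divff ?pnatr_eq0 // scale1r.
    by rewrite rmorphD scalerDl scale1r addrACA opprD.
  (* The midpoint of [v m] and [v n] lies in [E], so its squared distance to [w] is at least
     [inf D]. *)
  have := Dmin _ (EZ (2^-1 : R)%:C _ (ED _ _ Em En)).
  rewrite hnormZr // exprMn (hnormBC (v n)); lra.
have [x vx] : exists l, forall e, 0 < e -> exists N : nat, forall n, (N <= n)%N ->
    hnorm (v n - l) < e.
  apply: hnorm_cvg_cauchy => e e0.
  have /small [N hN] : 0 < e ^+ 2 / 4 by rewrite divr_gt0 // exprn_gt0.
  exists N => m n /hN hm /hN hn.
  rewrite -(@ltr_pXn2r _ 2) // ?nnegrE ?hnorm_ge0 // ?ltW //.
  by have := close m n; lra.
exists x; split.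
  apply/closure_hnormP => e /vx [N /(_ _ (leqnn N))].
  by rewrite hnormBC; exists (v N) => //; case: (hv N).
move=> y Ey; apply/eqP; rewrite -normr_le0; apply/ler_addgt0Pr => e e0.
rewrite add0r.
(* Two error terms of size [d * hnorm y] will have to fit into [e = d * k]; the added 1 keeps [k]
   positive when [y = 0]. *)
pose k := 2 * (hnorm y + 1); have y0 := hnorm_ge0 y.
have k0 : 0 < k by rewrite /k; lra.
pose d := e / k; have d0 : 0 < d by rewrite divr_gt0.
have /vx [N hN] := d0.
have /small [N' hN'] : 0 < d ^+ 2 by rewrite exprn_gt0.
have {hN hN'} [n [hn hn']] : exists n, hnorm (v n - x) < d /\ r n < d ^+ 2.
  by exists (maxn N N'); rewrite hN ?hN' // leq_max leqnn ?orbT.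
have [Ev hvn] := hv n.
(* Moving [v n] along [y] stays in [E] and so lowers the squared distance by at most [r n], whatever
   the step [t]; the discriminant turns this into near orthogonality. *)
have : rin (w - v n) y ^+ 2 <= r n * hnorm y ^+ 2.
  apply: discriminant_le0 => [|t]; first by rewrite exprn_ge0.
  have := Dmin _ (Elin (- t)%:C _ _ Ey Ev).
  have -> : w - ((- t)%:C *: y + v n) = (w - v n) + t%:C *: y.
    by rewrite rmorphN scaleNr opprD opprK addrCA addrC.
  rewrite hnorm_sqrD rinZr !hnorm_sqr rinZl rinZr; move: hvn; rewrite !hnorm_sqr.
  lra.
move=> h; have -> : w - x = (w - v n) + (v n - x) by rewrite addrA subrK.
rewrite rinDl.
apply: (le_trans (ler_normD _ _)).
have dy0 : 0 <= d * hnorm y by apply: mulr_ge0 => //; exact: ltW.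
have h1 : `|rin (w - v n) y| <= d * hnorm y.
  rewrite -(@ler_pXn2r _ 2) // ?nnegrE //.
  rewrite real_normK ?num_real // exprMn (le_trans h) //.
  by rewrite ler_wpM2r ?exprn_ge0 // ltW.
have h2 : `|rin (v n - x) y| <= d * hnorm y.
  by rewrite (le_trans (cauchy_schwarz _ _)) // ler_wpM2r // ltW.
have ek : d * k = e by rewrite /d divfK // gt_eqF.
apply: (le_trans (lerD h1 h2)); move: ek; rewrite /k; clear -d0; lra.
Qed.

End Projection.

(** * Extension of densely defined contractions *)

Section Extension.
Context {R : realType} {X Y : hilbert R}.

Definition mk_bounded_op (f : X -> Y) (lf : linear f)
    (bf : exists M : R, forall x, hnorm (f x) <= M * hnorm x) :
    bounded_op X Y :=
  let g : {linear X -> Y} := HB.pack f (GRing.isLinear.Build _ _ _ _ f lf) in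
  @BoundedOp R X Y g bf.

Lemma mk_bounded_opE f lf bf : mk_bounded_op (f := f) lf bf = f :> (X -> Y).
Proof. by []. Qed.

(* The graph of the extension is the closure of the set of pairs
   [(S x, T x)]. *)
Lemma contraction_extension (Z : hilbert R) (S : partial_op Z X) (T : Z -> Y) :
  linear_op S -> dense (op_range S) ->
  (forall (c : R[i]) x y, dom S x -> dom S y -> T (c *: x + y) = c *: T x + T y) ->
  (forall x, dom S x -> hnorm (T x) <= hnorm (S x)) ->
  exists G : bounded_op X Y, forall x, dom S x -> G (S x) = T x.
Proof.
move=> [S0 Slin] /dense_closure Sdense Tlin TS.
pose gr x y := forall e : R, 0 < e -> exists z, [/\ dom S z,
  hnorm (x - S z) < e & hnorm (y - T z) < e].
have gr_le x y : gr x y -> hnorm y <= hnorm x.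
  move=> g; apply/ler_addgt0Pr => e e0.
  have /g [z [Sz xz yz]] : 0 < e / 2 by lra.
  have := hnormD (y - T z) (T z); rewrite subrK.
  have := hnormD (S z - x) x; rewrite subrK hnormBC.
  have := TS z Sz; lra.
have gr_lin c x y x' y' : gr x y -> gr x' y' -> gr (c *: x + x') (c *: y + y').
  move=> g g' e e0.
  have k0 : 0 <= complex.Re `|c| by rewrite -ler0c RRe_real ?normr_real.
  set k := complex.Re `|c| in k0.
  have d0 : 0 < e / (k + 1) by apply: divr_gt0 => //; lra.
  have ke : k * (e / (k + 1)) + e / (k + 1) = e.
    by field; rewrite gt_eqF //; lra.
  have [z [Sz xz yz]] := g _ d0; have [z' [Sz' xz' yz']] := g' _ d0.
  have [Sl Se] := Slin c z z' Sz Sz'.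
  exists (c *: z + z'); rewrite Tlin // Se.
  have aux (V : hilbert R) (a b a' b' : V) : hnorm (a - b) < e / (k + 1) ->
      hnorm (a' - b') < e / (k + 1) ->
      hnorm (c *: a + a' - (c *: b + b')) < e.
    move=> h h'.
    have -> : c *: a + a' - (c *: b + b') = c *: (a - b) + (a' - b').
      by rewrite scalerBr opprD addrACA.
    apply: (le_lt_trans (hnormD _ _)); rewrite hnormZ -/k -ke.
    by rewrite ler_ltD // ler_wpM2l // ltW.
  by split; [|exact: aux|exact: aux].
(* By linearity the pair [(0, y - y')] is in the closed graph, and [gr_le] forces its second
   component to vanish. *)
have gr_fun x y y' : gr x y -> gr x y' -> y = y'.
  move=> g g'; apply/eqP; rewrite -subr_eq0; apply/eqP/hnorm_eq0/le_anti.
  rewrite hnorm_ge0 andbT -(hnorm0 (X := X)); apply: gr_le.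
  have -> : (0 : X) = (- 1) *: x + x by rewrite scaleN1r addNr.
  have -> : y - y' = (- 1) *: y' + y by rewrite scaleN1r addrC.
  exact: gr_lin.
have gr_S x : dom S x -> gr (S x) (T x).
  by move=> Sx e e0; exists x; rewrite !subrr !hnorm0.
have gr_total x : exists y, gr x y.
  have [r r0 small] := null_sequence R.
  have /choice [z hz] : forall n : nat, exists z, dom S z /\ hnorm (x - S z) < r n.
    move=> n; have /closure_hnormP/(_ _ (r0 n)) := Sdense x.
    by case=> _ [z Sz <-] xz; exists z.
  (* The [S (z n)] converge to [x], so this domination makes the [T (z n)] a Cauchy sequence. *)
  have TB m n : hnorm (T (z m) - T (z n)) <= hnorm (S (z m) - S (z n)).
    have [[zm _] [zn _]] := (hz m, hz n).
    have [d1 d2] := Slin (- 1) _ _ zn zm.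
    have := TS _ d1; rewrite Tlin // d2 !scaleN1r.
    by rewrite ![- _ + _]addrC.
  have [y hy] : exists l, forall e, 0 < e -> exists N : nat, forall n, (N <= n)%N ->
      hnorm (T (z n) - l) < e.
    apply: hnorm_cvg_cauchy => e e0.
    have /small [N hN] : 0 < e / 2 by lra.
    exists N => m n /hN hm /hN hn; apply: (le_lt_trans (TB m n)).
    have -> : S (z m) - S (z n) = (S (z m) - x) + (x - S (z n)).
      by rewrite addrA subrK.
    apply: (le_lt_trans (hnormD _ _)); rewrite hnormBC.
    have [[_ ?] [_ ?]] := (hz m, hz n); lra.
  exists y => e e0; have [[N hN] [N' hN']] := (small e e0, hy e e0).
  exists (z (maxn N N')); have [? h] := hz (maxn N N'); split => //.
    by rewrite (lt_trans h) // hN // leq_maxl.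
  by rewrite hnormBC hN' // leq_maxr.
have /choice [f hf] := gr_total.
have flin : linear f.
  by move=> c x y; apply: (gr_fun (c *: x + y)) => //; exact: gr_lin.
have fb : exists M : R, forall x, hnorm (f x) <= M * hnorm x.
  by exists 1 => x; rewrite mul1r; exact: gr_le.
exists (mk_bounded_op flin fb) => x Sx; rewrite mk_bounded_opE.
exact: (gr_fun (S x)) (hf _) (gr_S _ Sx).
Qed.

End Extension.

(** * Adjoints, kernels and ranges of selfadjoint operators *)

Section SelfAdjoint.
Context {R : realType} {X : hilbert R}.

Lemma rin_closure0 (E : set X) x :
  (forall y, E y -> rin x y = 0) -> forall y, closure E y -> rin x y = 0.
Proof.
move=> h y /closure_hnormP yE; apply/eqP; rewrite -normr_le0.
apply/ler_addgt0Pr => e e0; rewrite add0r.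
have x0 := hnorm_ge0 x.
have k0 : 0 < hnorm x + 1 by lra.
have /yE [z Ez yz] : 0 < e / (hnorm x + 1) by exact: divr_gt0.
rewrite -(subrK z y) rinDr (h _ Ez) addr0.
apply: (le_trans (cauchy_schwarz _ _)).
have : e / (hnorm x + 1) * (hnorm x + 1) = e by rewrite divfK // gt_eqF.
move: yz; set d := e / _ => yz <-.
by rewrite mulrC ler_pM ?hnorm_ge0 // ?ltW //; lra.
Qed.

(** The difference [z - z'] is orthogonal to the dense domain, hence to itself. *)
Lemma adjoint_unique (Y : hilbert R) (T : partial_op X Y) y z z' :
  dense (dom T) -> adjoint_spec T y z -> adjoint_spec T y z' -> z = z'.
Proof.
move=> /dense_closure dT hz hz'; apply/eqP; rewrite -subr_eq0.
apply/eqP/hnorm_eq0/eqP; rewrite -sqrf_eq0 hnorm_sqr; apply/eqP.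
apply: (rin_closure0 _ (dT _)) => x Tx.
by rewrite rinDl rinNl rinC (rinC z') /rin -hz // -hz' // subrr.
Qed.

(** The orthogonal complement of the range is the kernel of the adjoint, and the adjoint is [T]
    itself, domain included. *)
Lemma selfadjoint_orthogonal_range (T : partial_op X X) y :
  selfadjoint T -> (forall x, dom T x -> inner X (T x) y = 0) ->
  dom T y /\ T y = 0.
Proof.
move=> [Tlin dT [domE valE]] h.
have h0 : adjoint_spec T y 0.
  by move=> x Tx; rewrite h // innerC linear0l rmorph0.
have ady : dom (adjoint T) y by exists 0.
split; first by rewrite -domE.
rewrite -valE //; apply: (adjoint_unique dT) h0.
exact: (xgetPex 0 (P := [set z | adjoint_spec T y z])).
Qed.

Lemma linear_op_rangeP (Y : hilbert R) (T : partial_op X Y) : linear_op T ->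
  op_range T 0 /\ forall (c : R[i]) x y, op_range T x -> op_range T y ->
  op_range T (c *: x + y).
Proof.
move=> [T0 Tlin]; split.
  exists 0 => //; have [_] := Tlin 1 0 0 T0 T0.
  by rewrite !scale1r addr0 => /eqP; rewrite -subr_eq0 opprD addNKr oppr_eq0 => /eqP.
move=> c _ _ [x Tx <-] [y Ty <-].
by have [? ?] := Tlin c x y Tx Ty; exists (c *: x + y).
Qed.

(** Project [w] onto the closure of the range: the residual is orthogonal to the range, hence in the
    kernel, hence zero. *)
Lemma selfadjoint_dense_range (T : partial_op X X) :
  selfadjoint T -> (forall x, dom T x -> T x = 0 -> x = 0) ->
  dense (op_range T).
Proof.
move=> sT inj; apply/dense_closure => w.
have [r0 rlin] := linear_op_rangeP (let: And3 l _ _ := sT in l).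
have [x [xr orth]] := orthogonal_projection w r0 rlin.
have [d e] : dom T (w - x) /\ T (w - x) = 0.
  apply: selfadjoint_orthogonal_range => // z Tz.
  rewrite innerC -[RHS](rmorph0 Num.conj); congr (Num.conj _).
  rewrite -(linear0l (inner X) 0).
  apply: rin_inner_eq => c; rewrite rin0l orth //.
  by rewrite -[c *: _]addr0; apply: rlin => //; exists z.
by have /eqP := inj _ d e; rewrite subr_eq0 => /eqP ->.
Qed.

End SelfAdjoint.

(** * Square root of a positive contraction by iteration *)

Section SquareRoot.
Context {R : realType} {X : hilbert R}.

(** Cauchy-Schwarz for the form of [K] at [x] and [K x] gives [|K x|^4 <= |x|^2 * |K x|^2]. *)
Lemma positive_contraction (K : {linear X -> X}) :
  (forall x y, rin (K x) y = rin x (K y)) -> (forall x, 0 <= rin (K x) x) ->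
  (forall x, rin (K x) x <= hnorm x ^+ 2) ->
  forall x, hnorm (K x) <= hnorm x.
Proof.
move=> sym pos le1 x; have := form_cauchy_schwarz sym pos x (K x).
rewrite -hnorm_sqr => h.
have [->|k0] := eqVneq (hnorm (K x)) 0; first exact: hnorm_ge0.
rewrite -(@ler_pXn2r _ 2) ?nnegrE ?hnorm_ge0 //.
have kp : 0 < hnorm (K x) ^+ 2 by rewrite exprn_gt0 // lt_def k0 hnorm_ge0.
rewrite -(ler_pM2r kp) -expr2 (le_trans h) // ler_pM //.
Qed.

(* Operators that are polynomials in [K] without constant term and with
   nonnegative coefficients, indexed by the sum of the coefficients. *)
Inductive nonneg_poly (K : X -> X) : R -> (X -> X) -> Prop :=
| nonneg_polyX : nonneg_poly K 1 K
| nonneg_poly0 : nonneg_poly K 0 (fun=> 0)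
| nonneg_polyD a b S T : nonneg_poly K a S -> nonneg_poly K b T ->
    nonneg_poly K (a + b) (fun x => S x + T x)
| nonneg_polyZ c a S : 0 <= c -> nonneg_poly K a S ->
    nonneg_poly K (c * a) (fun x => c%:C *: S x)
| nonneg_polyM a b S T : nonneg_poly K a S -> nonneg_poly K b T ->
    nonneg_poly K (a * b) (fun x => S (T x)).

Lemma nonneg_poly_linear (K : {linear X -> X}) a S : nonneg_poly K a S -> linear S.
Proof.
elim=> [|c x y|b c S1 T1 _ lS _ lT d x y|b c S1 _ _ lS d x y
  |b c S1 T1 _ lS _ lT d x y].
- exact: linearP.
- by rewrite scaler0 addr0.
- by rewrite lS lT scalerDr addrACA.
- by rewrite lS scalerDr !scalerA (mulrC d).
- by rewrite lT lS.
Qed.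

Lemma nonneg_poly_norm (K : {linear X -> X}) a S :
  (forall x, hnorm (K x) <= hnorm x) -> nonneg_poly K a S ->
  0 <= a /\ forall x, hnorm (S x) <= a * hnorm x.
Proof.
move=> K1; elim=> [||b c S1 T1 _ [b0 lS] _ [c0 lT]|b c S1 b0 _ [c0 lS]
  |b c S1 T1 _ [b0 lS] _ [c0 lT]].
- by split=> // x; rewrite mul1r.
- by split=> // x; rewrite hnorm0 mul0r.
- split=> [|x]; first exact: addr_ge0.
  by rewrite mulrDl (le_trans (hnormD _ _)) // lerD.
- split=> [|x]; first exact: mulr_ge0.
  by rewrite hnormZr // -mulrA ler_wpM2l.
- split=> [|x]; first exact: mulr_ge0.
  by rewrite (le_trans (lS _)) // -mulrA ler_wpM2l.
Qed.

(** Fixed-point iteration, started at 0, for [Y = (K + Y^2) / 2], an equation equivalent to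
    [(1 - Y)^2 = 1 - K]. *)
Fixpoint sqrt_iter (K : X -> X) (n : nat) : X -> X :=
  if n is m.+1 then
    fun x => (2^-1 : R)%:C *: (K x + sqrt_iter K m (sqrt_iter K m x))
  else fun=> 0.

(** The same iteration for the scalar [K = 1]; it gives the coefficient sum of the polynomial
    [sqrt_iter K n]. *)
Fixpoint sqrt_coef (n : nat) : R :=
  if n is m.+1 then 2^-1 * (1 + sqrt_coef m * sqrt_coef m) else 0.

Lemma sqrt_coef_le1 n : 0 <= sqrt_coef n <= 1.
Proof. elim: n => [|n /andP[h0 h1]] /=; [lra|nra]. Qed.

Lemma sqrt_iter_poly K n : nonneg_poly K (sqrt_coef n) (sqrt_iter K n).
Proof.
elim: n => [|n ih] /=; first exact: nonneg_poly0.
apply: nonneg_polyZ; first by rewrite invr_ge0.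
apply: nonneg_polyD; first exact: nonneg_polyX.
exact: nonneg_polyM.
Qed.

(** Increments keep nonnegative coefficients: if the step from [Y] is [G], the next step is
    [(Y G + G Y + G^2) / 2], again a polynomial of the same kind. *)
Lemma sqrt_iterS (K : {linear X -> X}) n :
  exists2 G, nonneg_poly K (sqrt_coef n.+1 - sqrt_coef n) G &
    forall x, sqrt_iter K n.+1 x = sqrt_iter K n x + G x.
Proof.
have h0 : 0 <= 2^-1 :> R by rewrite invr_ge0.
elim: n => [|n [G pG eG]].
  exists (fun x => (2^-1 : R)%:C *: K x) => [|x]; last by rewrite /= addr0 add0r.
  rewrite /= mulr0 addr0 subr0; apply: nonneg_polyZ => //; exact: nonneg_polyX.
have pY := sqrt_iter_poly K n.
exists (fun x => (2^-1 : R)%:C *: (sqrt_iter K n (G x) +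
    (G (sqrt_iter K n x) + G (G x)))) => [|x].
  set a := sqrt_coef n.
  have -> : sqrt_coef n.+2 - sqrt_coef n.+1 =
    2^-1 * (a * (sqrt_coef n.+1 - a) + ((sqrt_coef n.+1 - a) * a +
       (sqrt_coef n.+1 - a) * (sqrt_coef n.+1 - a))).
    by rewrite /= -/a; field.
  apply: nonneg_polyZ => //; apply: nonneg_polyD; first exact: nonneg_polyM.
  by apply: nonneg_polyD; exact: nonneg_polyM.
have lY a b : sqrt_iter K n (a + b) = sqrt_iter K n a + sqrt_iter K n b.
  by have := nonneg_poly_linear pY 1 a b; rewrite !scale1r.
have lG a b : G (a + b) = G a + G b.
  by have := nonneg_poly_linear pG 1 a b; rewrite !scale1r.
have YS m z : sqrt_iter K m.+1 z =
    (2^-1 : R)%:C *: (K z + sqrt_iter K m (sqrt_iter K m z)) by [].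
rewrite (YS n.+1) [X in _ = X + _](YS n) !eG lY lG -scalerDr.
by rewrite -!addrA.
Qed.

(** Each increment is bounded in norm by its coefficient sum, and these sums telescope; operator
    convergence is thereby reduced to that of a scalar sequence. *)
Lemma sqrt_iter_dist (K : {linear X -> X}) m n x :
  (forall x, hnorm (K x) <= hnorm x) -> (m <= n)%N ->
  sqrt_coef m <= sqrt_coef n /\ hnorm (sqrt_iter K n x - sqrt_iter K m x) <=
    (sqrt_coef n - sqrt_coef m) * hnorm x.
Proof.
move=> K1; elim: n => [|n ih].
  by rewrite leqn0 => /eqP ->; rewrite !subrr hnorm0 mul0r !lexx.
rewrite leq_eqVlt => /predU1P[->|]; first by rewrite !subrr hnorm0 mul0r !lexx.
rewrite ltnS => /ih [le_mn dmn].
have [G /(nonneg_poly_norm K1) [g0 Gle] eG] := sqrt_iterS K n.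
split; first by apply: (le_trans le_mn); rewrite -subr_ge0.
rewrite eG addrAC (le_trans (hnormD _ _)) //.
apply: (le_trans (lerD dmn (Gle x))); rewrite -mulrDl.
by rewrite ler_wpM2r ?hnorm_ge0 // addrC addrA subrK.
Qed.

Lemma sqrt_iter_sym (K : {linear X -> X}) n :
  (forall x y, rin (K x) y = rin x (K y)) ->
  forall x y, rin (sqrt_iter K n x) y = rin x (sqrt_iter K n y).
Proof.
move=> sym; elim: n => [|n ih] x y /=; first by rewrite rin0l rin0r.
by rewrite rinZl rinZr rinDl rinDr sym !ih.
Qed.

(** The coefficient sums increase and are bounded by 1, so the iterates are Cauchy at a rate
    proportional to [hnorm x]. *)
Lemma sqrt_iter_limit (K : {linear X -> X}) :
  (forall x, hnorm (K x) <= hnorm x) ->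
  exists Y : X -> X, forall e : R, 0 < e -> exists N : nat, forall n, (N <= n)%N ->
    forall x, hnorm (sqrt_iter K n x - Y x) <= e * hnorm x.
Proof.
move=> K1.
pose D := range sqrt_coef.
have Dsup : has_sup D.
  split; first by exists (sqrt_coef 0), 0%N.
  by exists 1 => _ [n _ <-]; case/andP: (sqrt_coef_le1 n).
have Dle n : sqrt_coef n <= sup D by apply: sup_upper_bound => //; exists n.
have coef_close e : 0 < e -> exists N, forall m n, (N <= m)%N -> (m <= n)%N ->
    forall x, hnorm (sqrt_iter K n x - sqrt_iter K m x) <= e * hnorm x.
  move=> /(sup_adherent)/(_ Dsup) [_ [N _ <-] hN]; exists N => m n Nm mn x.
  have [_ h] := sqrt_iter_dist x K1 mn; apply: (le_trans h).
  rewrite ler_wpM2r ?hnorm_ge0 //; have := Dle n.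
  have [+ _] := sqrt_iter_dist x K1 Nm; lra.
have coef_close2 e : 0 < e -> exists N, forall m n, (N <= m)%N -> (N <= n)%N ->
    forall x, hnorm (sqrt_iter K n x - sqrt_iter K m x) <= e * hnorm x.
  move=> /coef_close [N hN]; exists N => m n Nm Nn x.
  by have [/hN->//|/ltnW/hN h] := leqP m n; rewrite hnormBC h.
have /choice [Y hY] x : exists l, forall e, 0 < e -> exists N : nat,
    forall n, (N <= n)%N -> hnorm (sqrt_iter K n x - l) < e.
  apply: hnorm_cvg_cauchy => e e0.
  have x0 : 0 < hnorm x + 1 by have := hnorm_ge0 x; lra.
  have /coef_close2 [N hN] : 0 < e / (hnorm x + 1) by apply: divr_gt0.
  exists N => m n Nm Nn; apply: (le_lt_trans (hN _ _ Nn Nm x)).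
  by rewrite mulrAC ltr_pdivrMr // ltr_pM2l //; lra.
exists Y => e /coef_close2 [N hN]; exists N => n Nn x.
(* The rate passes to the pointwise limit through a later iterate, which is within an arbitrary [d]
   of the limit at [x]. *)
apply/ler_addgt0Pr => d /hY - /(_ x) [N' hN'].
have Nm : (N <= maxn N N')%N by rewrite leq_maxl.
have := hN' (maxn N N') (leq_maxr _ _); have := hN _ _ Nm Nn x.
set u := sqrt_iter K n x; set v := sqrt_iter K (maxn N N') x.
have -> : u - Y x = (u - v) + (v - Y x) by rewrite addrA subrK.
have := hnormD (u - v) (v - Y x); lra.
Qed.

Lemma hnorm_small_eq (x y : X) (k : R) :
  (forall e : R, 0 < e -> hnorm (x - y) <= e * k) -> x = y.
Proof.
move=> h; apply/eqP; rewrite -subr_eq0; apply/eqP/hnorm_eq0/le_anti.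
rewrite hnorm_ge0 andbT; apply/ler_addgt0Pr => e e0; rewrite add0r.
have k1 : 0 < `|k| + 1 by rewrite ltr_wpDl.
apply: (le_trans (h (e / (`|k| + 1)) _)); first exact: divr_gt0.
rewrite mulrAC ler_pdivrMr // ler_pM2l //.
by have := ler_norm k; lra.
Qed.

(* [1 - sqrt (1 - K)] is the limit of the iteration. *)
Lemma positive_contraction_sqrt (T : {linear X -> X}) :
  (forall x y, rin (T x) y = rin x (T y)) -> (forall x, 0 <= rin (T x) x) ->
  (forall x, rin (T x) x <= hnorm x ^+ 2) ->
  exists Q : X -> X, [/\ linear Q, forall x y, rin (Q x) y = rin x (Q y),
    forall x, 0 <= rin (Q x) x & forall x, Q (Q x) = T x].
Proof.
move=> symT pos le1.
(* The iteration is run with [K = 1 - T], so that the root of [T] is [1 - Y] for its limit [Y]. *)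
have lK : linear (fun x => x - T x).
  by move=> c x y; rewrite linearP scalerBr opprD addrACA.
pose K : {linear X -> X} :=
  HB.pack (fun x => x - T x) (GRing.isLinear.Build _ _ _ _ _ lK).
have KE x : K x = x - T x by [].
have symK x y : rin (K x) y = rin x (K y).
  by rewrite !KE rinDl rinDr rinNl rinNr symT.
have K1 : forall x, hnorm (K x) <= hnorm x.
  apply: positive_contraction => // x; rewrite KE rinDl rinNl -hnorm_sqr.
    by rewrite subr_ge0.
  by rewrite gerBl.
have [Y hY] := sqrt_iter_limit K1.
have Yn1 n x : hnorm (sqrt_iter K n x) <= hnorm x.
  have [_ /(_ x) h] := nonneg_poly_norm K1 (sqrt_iter_poly K n).
  apply: (le_trans h); rewrite ler_piMl ?hnorm_ge0 //.
  by case/andP: (sqrt_coef_le1 n).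
have lYn n : linear (sqrt_iter K n).
  exact: nonneg_poly_linear (sqrt_iter_poly K n).
have hY1 e : 0 < e -> exists n,
    (forall x, hnorm (sqrt_iter K n x - Y x) <= e * hnorm x) /\ (forall x, hnorm (sqrt_iter K n.+1 x - Y x) <= e * hnorm x).
  by move=> /hY [N hN]; exists N; split; apply: hN.
have Y1 x : hnorm (Y x) <= hnorm x.
  apply/ler_addgt0Pr => e e0.
  have x0 := hnorm_ge0 x; have x1 : 0 < hnorm x + 1 by lra.
  have /hY1 [n [h _]] : 0 < e / (hnorm x + 1) by exact: divr_gt0.
  have {}h : hnorm (sqrt_iter K n x - Y x) <= e.
    apply: (le_trans (h x)); rewrite mulrAC ler_pdivrMr // ler_pM2l //; lra.
  have := hnormD (Y x - sqrt_iter K n x) (sqrt_iter K n x).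
  rewrite subrK hnormBC; have := Yn1 n x; lra.
have lY : linear Y.
  move=> c x y.
  apply: (@hnorm_small_eq _ _
    (hnorm (c *: x + y) + (complex.Re `|c| * hnorm x + hnorm y))) => e.
  move=> /hY1 [n [h _]].
  set Yn := sqrt_iter K n in h.
  have -> : Y (c *: x + y) - (c *: Y x + Y y) =
    (Y (c *: x + y) - Yn (c *: x + y)) + (c *: (Yn x - Y x) + (Yn y - Y y)).
    have -> : Yn (c *: x + y) = c *: Yn x + Yn y by exact: lYn.
    have <- : c *: Yn x + Yn y - (c *: Y x + Y y) =
      c *: (Yn x - Y x) + (Yn y - Y y) by rewrite scalerBr opprD addrACA.
    by rewrite addrA subrK.
  rewrite mulrDr (le_trans (hnormD _ _)) // lerD //; first by rewrite hnormBC.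
  rewrite mulrDr (le_trans (hnormD _ _)) // lerD // hnormZ mulrCA ler_wpM2l //.
  by rewrite -ler0c RRe_real ?normr_real.
have symY x y : rin (Y x) y = rin x (Y y).
  apply/eqP; rewrite -subr_eq0 -normr_le0; apply/ler_addgt0Pr => e e0.
  rewrite add0r.
  have [x0 y0] := (hnorm_ge0 x, hnorm_ge0 y).
  have k1 : 0 < 2 * (hnorm x * hnorm y) + 1.
    by have := mulr_ge0 x0 y0; lra.
  have d0 : 0 < e / (2 * (hnorm x * hnorm y) + 1) by exact: divr_gt0.
  have [n [h _]] := hY1 _ d0; move: h; set d := e / _ => h.
  have -> : rin (Y x) y - rin x (Y y) =
    rin x (sqrt_iter K n y - Y y) - rin (sqrt_iter K n x - Y x) y.
    by rewrite rinDl rinDr rinNl rinNr sqrt_iter_sym //; lra.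
  have := cauchy_schwarz x (sqrt_iter K n y - Y y).
  have := cauchy_schwarz (sqrt_iter K n x - Y x) y.
  have := ler_normB (rin x (sqrt_iter K n y - Y y)) (rin (sqrt_iter K n x - Y x) y).
  have := ler_wpM2l x0 (h y); have := ler_wpM2r y0 (h x).
  have : d * (2 * (hnorm x * hnorm y) + 1) = e by rewrite /d divfK // gt_eqF.
  have d0' : 0 < d by []; lra.
have YE x : (2 : R)%:C *: Y x = K x + Y (Y x).
  apply: (@hnorm_small_eq _ _ (4 * hnorm x)) => e e0.
  have [n [h h']] := hY1 _ e0; set Yn := sqrt_iter K n in h.
  have YnE : (2 : R)%:C *: sqrt_iter K n.+1 x = K x + Yn (Yn x).
    rewrite /= scalerA -rmorphM divff ?pnatr_eq0 //; exact: scale1r.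
  have YnB a b : Yn (a - b) = Yn a - Yn b.
    have := lYn n (- 1) b a.
    by rewrite !scaleN1r ![- _ + _]addrC.
  (* The equation of the iteration is compared with its limit: the doubled term costs [2 e |x|], and
     the other two cost [e |x|] each since [Yn] and [Y] are contractions. *)
  have -> : (2 : R)%:C *: Y x - (K x + Y (Y x)) =
     (2 : R)%:C *: (Y x - sqrt_iter K n.+1 x) +
     (Yn (Yn x - Y x) + (Yn (Y x) - Y (Y x))).
    rewrite scalerBr YnE YnB [Yn (Yn x) - _ + _]addrA subrK.
    by rewrite !(opprD (K x)) !(addrA _ (- K x)) subrKA.
  have -> : e * (4 * hnorm x) = 2 * (e * hnorm x) + (e * hnorm x + e * hnorm x).
    by ring.
  rewrite (le_trans (hnormD _ _)) // lerD //.
    by rewrite hnormZr // ler_wpM2l // hnormBC.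
  rewrite (le_trans (hnormD _ _)) // lerD //.
    by apply: (le_trans (Yn1 _ _)).
  by apply: (le_trans (h _)); rewrite ler_wpM2l // ltW.
exists (fun x => x - Y x); split.
- by move=> c x y; rewrite lY scalerBr opprD addrACA.
- by move=> x y; rewrite rinDl rinDr rinNl rinNr symY.
- move=> x; rewrite rinDl rinNl -hnorm_sqr subr_ge0.
  apply: (le_trans (ler_norm _)); apply: (le_trans (cauchy_schwarz _ _)).
  by rewrite expr2 ler_wpM2r ?hnorm_ge0.
- move=> x; have YB a b : Y (a - b) = Y a - Y b.
    by have := lY (- 1) b a; rewrite !scaleN1r ![- _ + _]addrC.
  (* With [Y^2 = 2 Y - K], expanding [(1 - Y)^2] leaves [1 - K = T]. *)
  have YY : Y (Y x) = Y x + Y x - (x - T x).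
    by rewrite -KE -[Y x]scale1r -scalerDl -(rmorph1 (real_complex R)) -rmorphD
      rmorph1 scale1r YE addrAC subrr add0r.
  by rewrite YB opprB YY (addrAC (Y x + Y x)) addrK subrKA opprB addrC subrK.
Qed.

End SquareRoot.

(** * Square roots and pseudo-inverses of partial operators *)

Section PartialOperators.
Context {R : realType}.

Lemma adjointP (X Y : hilbert R) (T : partial_op X Y) y :
  dom (adjoint T) y -> adjoint_spec T y (adjoint T y).
Proof. exact: xgetPex. Qed.

Lemma op_sqrtP (X : hilbert R) (T : partial_op X X) :
  (exists S, is_sqrt T S) -> is_sqrt T (op_sqrt T).
Proof. by rewrite /op_sqrt => h; case: pselect => // e; exact: projT2 (cid e). Qed.

(* The case without a square root is the junk value [op_sqrt T = T]. *)
Lemma op_sqrt_selfadjoint_inj (X : hilbert R) (T : partial_op X X) :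
  selfadjoint T -> (forall x, dom T x -> x != 0 -> 0 < inner X (T x) x) ->
  selfadjoint (op_sqrt T) /\
  forall x, dom (op_sqrt T) x -> op_sqrt T x = 0 -> x = 0.
Proof.
move=> saT pos.
have inj x : dom T x -> T x = 0 -> x = 0.
  move=> Tx T0; apply/eqP; apply: contraT => /(pos _ Tx).
  by rewrite T0 linear0l ltxx.
have [e|ne] := pselect (exists S, is_sqrt T S).
  have [saS _ [domE valE]] := op_sqrtP e; split=> // x Sx Sx0.
  have [[S0 _] _ _] := saS.
  (* As [0] lies in the domain of the root, [x] lies in that of its square, which is [T]; then
     [T x = 0]. *)
  have cx : dom (op_comp (op_sqrt T) (op_sqrt T)) x by split; rewrite ?Sx0.
  apply: inj; first by rewrite -domE.
  rewrite -valE //= Sx0; have [[_ Slin] _ _] := saS.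
  by have [_] := Slin (-1) 0 0 S0 S0; rewrite !scaleN1r !addNr.
have -> : op_sqrt T = T by rewrite /op_sqrt; case: pselect.
by [].
Qed.

(** The iteration supplies a root, so [op_sqrt T] is not its default value here. *)
Lemma bounded_op_sqrt (X : hilbert R) (T : partial_op X X) :
  dom T = setT -> linear T ->
  (forall x y, rin (T x) y = rin x (T y)) -> (forall x, 0 <= rin (T x) x) ->
  (forall x, rin (T x) x <= hnorm x ^+ 2) ->
  is_sqrt T (op_sqrt T).
Proof.
move=> domT linT symT posT leT; apply: op_sqrtP.
pose TL : {linear X -> X} :=
  HB.pack (T : X -> X) (GRing.isLinear.Build _ _ _ _ _ linT).
have [Q [linQ symQ posQ QQ]] := @positive_contraction_sqrt R X TL symT posT leT.
have isymQ x y : inner X (Q x) y = inner X x (Q y).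
  apply: rin_inner_eq => c; rewrite symQ.
  have := linQ c y 0; rewrite addr0 => ->.
  by have := linQ (-1) 0 0; rewrite !scaleN1r !addNr => ->; rewrite addr0.
have dT : dense (@setT X) by apply/dense_closure => x; exact: subset_closure.
exists (PartialOp setT Q); split.
- split=> //; first by split=> // c x y _ _; rewrite /= linQ.
  split=> [|y _].
    by apply/seteqP; split=> // y _; exists (Q y) => x _; exact: isymQ.
  apply: (@adjoint_unique _ _ _ (PartialOp setT Q) y _ _ dT).
    by apply: adjointP; exists (Q y) => x _; exact: isymQ.
  by move=> x _; exact: isymQ.
(* The order of [R[i]] also asks for a zero imaginary part, which symmetry gives. *)
- move=> x _ /=; rewrite lecE posQ andbT.
  have := isymQ x x; rewrite (innerC x); case: (inner X (Q x) x) => u v [] /=.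
  by move=> vN; apply/eqP; lra.
- by split=> [|x _]; [rewrite domT; apply/seteqP; split | exact: QQ].
Qed.

Lemma selfadjoint_sym (X : hilbert R) (T : partial_op X X) x y :
  selfadjoint T -> dom T x -> dom T y -> rin (T x) y = rin x (T y).
Proof.
move=> [_ _ [domE valE]] Tx; rewrite -domE => Ty.
by rewrite /rin -(valE y) // adjointP.
Qed.

(** For [c = Q v], the projection of [v] onto the closure of the range differs from [v] by a kernel
    vector, so [mp_spec] has a solution. Any solution [m] gives [c = Q m + z] with [z] both in the
    kernel and in the range, which are orthogonal; hence [z = 0]. *)
Lemma mp_inverse_range (X : hilbert R) (Q : partial_op X X) c :
  dom Q = setT -> selfadjoint Q -> op_range Q c ->
  closure (op_range Q) (mp_inverse Q c) /\ Q (mp_inverse Q c) = c.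
Proof.
move=> domQ saQ [v _ vc].
have Qall x : dom Q x by rewrite domQ.
have [linQ _ _] := saQ.
have [r0 rlin] := linear_op_rangeP linQ.
have QB x y : Q (x - y) = Q x - Q y.
  have [_ /(_ (-1) y x (Qall _) (Qall _)) [_]] := linQ.
  by rewrite !scaleN1r ![- _ + _]addrC.
have kerQ x : (forall y, op_range Q y -> rin x y = 0) -> Q x = 0.
  move=> h; apply/hnorm_eq0/eqP; rewrite -sqrf_eq0 hnorm_sqr.
  by rewrite selfadjoint_sym // h //; exists (Q x).
have [w [wcl wv]] := orthogonal_projection v r0 rlin.
have Q0 : Q 0 = 0 by have := QB 0 0; rewrite !subrr.
have mpw : exists x, mp_spec Q c x.
  exists w; split=> //; exists 0; split=> //.
  by rewrite addr0 -vc; apply/eqP; rewrite -subr_eq0 -QB kerQ.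
have : mp_spec Q c (mp_inverse Q c) by exact: xgetPex mpw.
move: (mp_inverse Q c) => m [_ mcl [z [_ Qz cE]]].
split=> //; suff z0 : z = 0 by rewrite cE z0 addr0.
have zr : op_range Q z.
  have -> : z = (-1) *: Q m + c by rewrite cE scaleN1r addKr.
  by apply: rlin; [exists m|exists v].
apply/hnorm_eq0/eqP; rewrite -sqrf_eq0 hnorm_sqr; apply/eqP.
case: zr => y _ {2}<-.
by rewrite -selfadjoint_sym // Qz rin0l.
Qed.

End PartialOperators.

(** * The quadratic form whose nonnegativity is passivity *)

Section Defect.
Context {R : realType} {X U Y : hilbert R}.

Definition defect (G : system X U Y) (x : X) (u : U) : R :=
  dsum_norm (x, u) ^+ 2 - dsum_norm (system_matrix G (x, u)) ^+ 2.

Lemma defectE (G : system X U Y) x u :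
  defect G x u = hnorm x ^+ 2 + hnorm u ^+ 2 -
    (hnorm (sysA G x + sysB G u) ^+ 2 + hnorm (sysC G x + sysD G u) ^+ 2).
Proof.
by rewrite /defect /dsum_norm !sqr_sqrtr //= addr_ge0 // exprn_ge0 ?hnorm_ge0.
Qed.

Lemma defect_parallelogram (G : system X U Y) x u x' u' :
  defect G (x + x') (u + u') + defect G (x - x') (u - u') =
  2 * defect G x u + 2 * defect G x' u'.
Proof.
have linD (V W Z : hilbert R) (S : bounded_op V Z) (T : bounded_op W Z) v v' w w' :
    S (v + v') + T (w + w') = S v + T w + (S v' + T w').
  by rewrite !linearD addrACA.
have linB (V W Z : hilbert R) (S : bounded_op V Z) (T : bounded_op W Z) v v' w w' :
    S (v - v') + T (w - w') = S v + T w - (S v' + T w').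
  by rewrite linD !linearN -opprD.
rewrite !defectE !linB !linD.
have := parallelogram x x'; have := parallelogram u u'.
have := parallelogram (sysA G x + sysB G u) (sysA G x' + sysB G u').
have := parallelogram (sysC G x + sysD G u) (sysC G x' + sysD G u').
lra.
Qed.

Lemma defect0_le (G : system X U Y) x : defect G x 0 <= hnorm x ^+ 2.
Proof.
rewrite defectE hnorm0 expr0n addr0 gerBl.
by rewrite addr_ge0 // exprn_ge0 ?hnorm_ge0.
Qed.

Lemma defectD (G : system X U Y) x d u :
  defect G (x + d) u = defect G x u +
  2 * (rin x d - rin (sysA G x + sysB G u) (sysA G d)
               - rin (sysC G x + sysD G u) (sysC G d)) + defect G d 0.
Proof.
rewrite !defectE !linear0 !addr0 hnorm0 expr0n /=.
have -> : sysA G (x + d) + sysB G u = sysA G x + sysB G u + sysA G d.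
  by rewrite linearD addrAC.
have -> : sysC G (x + d) + sysD G u = sysC G x + sysD G u + sysC G d.
  by rewrite linearD addrAC.
rewrite (hnorm_sqrD x) (hnorm_sqrD (_ + _) (sysA G d)).
rewrite (hnorm_sqrD (_ + _) (sysC G d)); lra.
Qed.

Lemma passive_defect (G : system X U Y) :
  (forall x u, 0 <= defect G x u) -> passive G.
Proof.
move=> h [x u]; rewrite -(@ler_pXn2r _ 2) ?nnegrE ?sqrtr_ge0 //.
by rewrite -subr_ge0 h.
Qed.

Lemma bounded_op_nonneg_bound (V W : hilbert R) (T : bounded_op V W) :
  exists2 M : R, 0 <= M & forall x, hnorm (T x) <= M * hnorm x.
Proof.
have [M hM] := Defs.bounded_funP T; exists `|M| => // x.
by rewrite (le_trans (hM x)) // ler_wpM2r ?hnorm_ge0 // ler_norm.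
Qed.

(** Continuity in [x] made explicit: by [defectD] a displacement [d] raises the value by at most
    [2 k |d| + |d|^2], so a negative value would persist at a nearby point of [E]. *)
Lemma defect_ge0_dense (G : system X U Y) (E : set X) u : dense E ->
  (forall x, E x -> 0 <= defect G x u) -> forall x, 0 <= defect G x u.
Proof.
move=> /dense_closure dE pos x; rewrite leNgt; apply/negP => neg.
have [MA A0 hA] := bounded_op_nonneg_bound (sysA G).
have [MC C0 hC] := bounded_op_nonneg_bound (sysC G).
pose a := sysA G x + sysB G u; pose c := sysC G x + sysD G u.
pose k := hnorm x + hnorm a * MA + hnorm c * MC.
have k0 : 0 <= k by rewrite !addr_ge0 ?mulr_ge0 ?hnorm_ge0.
have l0 : 0 < 2 * k + 1 - defect G x u by lra.
(* Writing [q] for the negative value, [e] satisfies [e < 1] and [(2 k + 1) e = - q + e q], so the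
   value at [y] is at most [e q < 0]. *)
pose e := - defect G x u / (2 * k + 1 - defect G x u).
have e0 : 0 < e by rewrite divr_gt0 // oppr_gt0.
have ek : e * (2 * k + 1 - defect G x u) = - defect G x u.
  by rewrite /e divfK // gt_eqF.
have /closure_hnormP/(_ _ e0) [y Ey xy] := dE x.
have := pos y Ey; rewrite leNgt => /negP; apply.
pose d := y - x.
have -> : y = x + d by rewrite /d addrC subrK.
have de : hnorm d < e by rewrite /d hnormBC.
have d0 := hnorm_ge0 d.
rewrite defectD -/a -/c.
have h1 := le_trans (ler_norm _) (cauchy_schwarz x d).
have h2 := le_trans (ler_norm _) (cauchy_schwarz a (- sysA G d)).
have h3 := le_trans (ler_norm _) (cauchy_schwarz c (- sysC G d)).
rewrite !rinNr !hnormN in h2 h3.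
have h4 := ler_wpM2l (hnorm_ge0 a) (hA d).
have h5 := ler_wpM2l (hnorm_ge0 c) (hC d).
have h6 := defect0_le G d.
have h7 : rin x d - rin a (sysA G d) - rin c (sysC G d) <= k * hnorm d.
  rewrite /k; lra.
have h8 : k * hnorm d <= k * e by rewrite ler_wpM2l // ltW.
have e1 : e < 1.
  by rewrite /e ltr_pdivrMr // mul1r; lra.
have h9 : hnorm d ^+ 2 <= e.
  rewrite expr2 (le_trans (ler_pM d0 d0 (ltW de) (ltW (lt_trans de e1)))) //.
  by rewrite mulr1.
have : 0 < e * (- defect G x u) by rewrite mulr_gt0 // oppr_gt0.
lra.
Qed.

(** Split [(x, u)] as [(y, u) + (x - y, 0)] with [y] in [E] near [x] and [u] nearly optimal for [y];
    by the parallelogram identity the value is at most twice the sum of the two values. *)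
Lemma defect_inf_dense (G : system X U Y) (E : set X) : dense E ->
  (forall x u, 0 <= defect G x u) ->
  (forall x, E x -> forall e : R, 0 < e -> exists u, defect G x u < e) ->
  forall x (e : R), 0 < e -> exists u, defect G x u < e.
Proof.
move=> /dense_closure dE pos hE x e e0.
(* The bound by 1 gives [|x - y|^2 <= |x - y|]; the quarter pays for two terms, each counted
   twice. *)
have m0 : 0 < Order.min 1 (e / 4) by rewrite lt_min ltr01 /=; lra.
have /closure_hnormP/(_ _ m0) [y Ey] := dE x.
rewrite lt_min => /andP[xy1 xy].
have [u hu] : exists u, defect G y u < e / 4 by apply: hE => //; lra.
exists u; have := defect_parallelogram G y u (x - y) 0.
rewrite addr0 [y + _]addrC subrK.
have := pos (y - (x - y)) (u - 0); have := defect0_le G (x - y).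
have : hnorm (x - y) ^+ 2 <= e / 4.
  have d0 := hnorm_ge0 (x - y).
  rewrite expr2 (le_trans (ler_pM d0 d0 (ltW xy1) (ltW xy))) // mul1r //.
lra.
Qed.

Lemma ereal_inf_EFin_eq0 (V : Type) (f : V -> R) : (forall v, 0 <= f v) ->
  ereal_inf [set (f v)%:E | v in [set: V]] = 0%E <->
  forall e : R, 0 < e -> exists v, f v < e.
Proof.
move=> f0; split=> [inf0 e e0|h].
  have /ereal_inf_lt [_ [v _ <-]] :
    (ereal_inf [set (f v)%:E | v in [set: V]] < e%:E)%E by rewrite inf0 lte_fin.
  by rewrite lte_fin; exists v.
apply/le_anti/andP; split.
  apply/lee_addgt0Pr => e e0; rewrite add0e.
  have [v hv] := h e e0; apply: ge_ereal_inf; exists (f v)%:E; first by exists v.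
  by rewrite lee_fin ltW.
by apply/ereal_infP => _ [v _ <-]; rewrite lee_fin.
Qed.

End Defect.

(** * The associated system and the completed square *)

Section KYP.
Context {R : realType} {X U Y : hilbert R} {Sig : system X U Y}
  {H : partial_op X X}.
Context (HRI : RI Sig H).

Local Notation A := (sysA Sig).
Local Notation B := (sysB Sig).
Local Notation C := (sysC Sig).
Local Notation D := (sysD Sig).
Local Notation S := (op_sqrt H).
Local Notation Q := (op_sqrt (delta Sig H)).

Lemma sqrtH_selfadjoint : selfadjoint S.
Proof.
by case: (op_sqrt_selfadjoint_inj (RI_selfadjoint HRI) (RI_positive HRI)).
Qed.

Lemma sqrtH_linear : linear_op S.
Proof. by case: sqrtH_selfadjoint. Qed.

Lemma sqrtH_dense_range : dense (op_range S).
Proof.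
have [sa inj] := op_sqrt_selfadjoint_inj (RI_selfadjoint HRI) (RI_positive HRI).
exact: selfadjoint_dense_range.
Qed.

Lemma domB u : dom S (B u).
Proof. by case: (RI_B HRI (x := u)). Qed.

Lemma domA x : dom S x -> dom S (A x).
Proof. by case/(RI_A HRI). Qed.

Lemma dom_delta : dom (delta Sig H) = setT.
Proof. by case: (RI_delta_bounded HRI). Qed.

(** As [delta] is defined everywhere, the adjoints in it are defined at the vectors [D u] and
    [S (B u)] and can be moved across the inner product. *)
Lemma inner_delta u v :
  inner U (delta Sig H u) v =
  inner U u v - inner Y (D u) (D v) - inner X (S (B u)) (S (B v)).
Proof.
have : dom (delta Sig H) u by rewrite dom_delta.
case=> -[_ [_ dD]] [_ dB].
rewrite innerC /= !linearB /= -(adjointP dD) // -(adjointP dB) //=; last first.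
  by split=> //; exact: domB.
by rewrite !rmorphB /= -!innerC.
Qed.

(** [is_bounded] does not include linearity; it is checked weakly, against every [w]. *)
Lemma delta_linear : linear (delta Sig H).
Proof.
have [S0 Slin] := sqrtH_linear.
have ext (u v : U) : (forall w, inner U u w = inner U v w) -> u = v.
  move=> h; apply/eqP; rewrite -subr_eq0; apply/eqP/hnorm_eq0/eqP.
  by rewrite -sqrf_eq0 hnorm_sqr rinDl rinNl /rin h subrr.
move=> c u v; apply: ext => w.
rewrite [in RHS]innerDl [in RHS]innerZl !inner_delta !linearP /=.
have [_ ->] := Slin c _ _ (domB u) (domB v).
rewrite !innerDl !innerZl; ring.
Qed.

Lemma rin_delta u v :
  rin (delta Sig H u) v = rin u v - rin (D u) (D v) - rin (S (B u)) (S (B v)).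
Proof. by rewrite /rin inner_delta !raddfB. Qed.

Lemma rin_delta_self u :
  rin (delta Sig H u) u = hnorm u ^+ 2 - hnorm (D u) ^+ 2 - hnorm (S (B u)) ^+ 2.
Proof. by rewrite rin_delta !hnorm_sqr. Qed.

Lemma rin_delta_ge0 u : 0 <= rin (delta Sig H u) u.
Proof.
have : dom (delta Sig H) u by rewrite dom_delta.
by move=> /(RI_delta_nonneg HRI); rewrite lecE => /andP[].
Qed.

(** The form of [delta] is the squared norm minus two squares, so it meets the upper bound of
    [bounded_op_sqrt]. *)
Lemma sqrt_deltaP : is_sqrt (delta Sig H) Q.
Proof.
apply: bounded_op_sqrt => [||u v||u].
- exact: dom_delta.
- exact: delta_linear.
- by rewrite (rinC u) !rin_delta (rinC v) (rinC (D v)) (rinC (S (B v))).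
- exact: rin_delta_ge0.
- rewrite rin_delta_self.
  have := exprn_ge0 2 (hnorm_ge0 (D u)); have := exprn_ge0 2 (hnorm_ge0 (S (B u))).
  lra.
Qed.

Lemma sqrt_delta_selfadjoint : selfadjoint Q.
Proof. by case: sqrt_deltaP. Qed.

Lemma dom_sqrt_delta : dom Q = setT.
Proof.
have [_ _ [domE _]] := sqrt_deltaP; apply/seteqP; split=> // u _.
by have : setT u by []; rewrite -dom_delta -domE => -[].
Qed.

Lemma sqrt_delta_sym u v : rin (Q u) v = rin u (Q v).
Proof.
by apply: selfadjoint_sym; rewrite ?dom_sqrt_delta //; exact: sqrt_delta_selfadjoint.
Qed.

Lemma hnorm_sqrt_delta u :
  hnorm (Q u) ^+ 2 = hnorm u ^+ 2 - hnorm (D u) ^+ 2 - hnorm (S (B u)) ^+ 2.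
Proof.
rewrite hnorm_sqr sqrt_delta_sym rinC -rin_delta_self.
have [_ _ [domE valE]] := sqrt_deltaP.
by rewrite -valE // domE dom_delta.
Qed.

Lemma rin_cross x u : dom S x ->
  rin (cross_op Sig H x) u = rin (C x) (D u) + rin (S (A x)) (S (B u)).
Proof.
move=> /(RI_cross HRI) [[[_ dD] [_ dB]] _].
rewrite rinC /= rinDr /rin -(adjointP dD) // -(adjointP dB) /=.
  by rewrite -!/(rin _ _) (rinC (D u)) (rinC (S (B u))).
by split=> //; exact: domB.
Qed.

(** Nonnegativity of [kyp_rhs] leaves [|S (A x)|^2 + |C x|^2 <= |S x|^2], so both prescriptions on
    the dense range of [S] are contractions and extend. *)
Lemma associated_exists : exists G, associated Sig H G.
Proof.
have [S0 Slin] := sqrtH_linear.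
have kyp x : dom S x ->
    hnorm (S (A x)) ^+ 2 + hnorm (C x) ^+ 2 <= hnorm (S x) ^+ 2.
  move=> Sx; have := le_trans (exprn_ge0 2 (hnorm_ge0 _)) (RI_kyp HRI Sx).
  rewrite /kyp_lhs; lra.
have [GA hA] : exists G : bounded_op X X, forall x, dom S x -> G (S x) = S (A x).
  apply: (contraction_extension (T := fun x => S (A x))) => //.
  - exact: sqrtH_dense_range.
  - move=> c x y Sx Sy; rewrite linearP.
    by have [_ ->] := Slin c _ _ (domA Sx) (domA Sy).
  - move=> x Sx; rewrite -(@ler_pXn2r _ 2) ?nnegrE ?hnorm_ge0 //.
    by have := kyp x Sx; have := exprn_ge0 2 (hnorm_ge0 (C x)); lra.
have [GC hC] : exists G : bounded_op X Y, forall x, dom S x -> G (S x) = C x.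
  apply: contraction_extension => //.
  - exact: sqrtH_dense_range.
  - by move=> c x y _ _; rewrite linearP.
  - move=> x Sx; rewrite -(@ler_pXn2r _ 2) ?nnegrE ?hnorm_ge0 //.
    by have := kyp x Sx; have := exprn_ge0 2 (hnorm_ge0 (S (A x))); lra.
have linSB : linear (fun u => S (B u)).
  move=> c u v; rewrite linearP.
  by have [_ ->] := Slin c _ _ (domB u) (domB v).
have bSB : exists M : R, forall u, hnorm (S (B u)) <= M * hnorm u.
  (* The bound 1 comes from the nonnegativity of [delta]. *)
  exists 1 => u; rewrite mul1r -(@ler_pXn2r _ 2) ?nnegrE ?hnorm_ge0 //.
  have := rin_delta_ge0 u; rewrite rin_delta_self.
  by have := exprn_ge0 2 (hnorm_ge0 (D u)); lra.
by exists (System GA (mk_bounded_op linSB bSB) GC D); split.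
Qed.

Lemma assoc_systemP : associated Sig H (assoc_system Sig H).
Proof.
rewrite /assoc_system; case: pselect => [e|[]]; last exact: associated_exists.
exact: projT2 (cid e).
Qed.

Lemma defect_sqrtH x u : dom S x ->
  defect (assoc_system Sig H) (S x) u =
  kyp_lhs Sig H x - kyp_rhs Sig H x +
  hnorm (mp_inverse Q (cross_op Sig H x) - Q u) ^+ 2.
Proof.
move=> Sx; have [hA hB hC hD] := assoc_systemP.
rewrite defectE hA // hB hC // hD /kyp_lhs /kyp_rhs.
have [_ Qw] := mp_inverse_range dom_sqrt_delta sqrt_delta_selfadjoint
  (proj2 (RI_cross HRI Sx)).
(* With [Q w] equal to the cross term, the mixed terms combine into [rin w (Q u)], the one occurring
   in [|w - Q u|^2]. *)
have := rin_cross u Sx; rewrite -{1}Qw sqrt_delta_sym.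
rewrite hnorm_sqrB hnorm_sqrt_delta !hnorm_sqrD; lra.
Qed.

Lemma assoc_defect_ge0 x u : 0 <= defect (assoc_system Sig H) x u.
Proof.
move: x; apply: (defect_ge0_dense sqrtH_dense_range) => _ [x Sx <-].
by rewrite defect_sqrtH // addr_ge0 ?exprn_ge0 ?hnorm_ge0 // subr_ge0 RI_kyp.
Qed.

Lemma assoc_defect_inf x e : dom S x -> 0 < e ->
  exists u, defect (assoc_system Sig H) (S x) u <
    kyp_lhs Sig H x - kyp_rhs Sig H x + e.
Proof.
move=> Sx e0.
have [/closure_hnormP wcl _] := mp_inverse_range dom_sqrt_delta
  sqrt_delta_selfadjoint (proj2 (RI_cross HRI Sx)).
(* A distance below both 1 and [e] has its square below [e]. *)
have m0 : 0 < Order.min 1 e by rewrite lt_min ltr01.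
have [_ [u _ <-]] := wcl _ m0; rewrite lt_min => /andP[w1 we].
exists u; rewrite defect_sqrtH // ltrD2l expr2.
have w0 := hnorm_ge0 (mp_inverse Q (cross_op Sig H x) - Q u).
by apply: (le_lt_trans (ler_piMl w0 (ltW w1))).
Qed.

End KYP.

Theorem theorem2p2 (R : realType) (X U Y : hilbert R) (Sig : system X U Y)
    (H : partial_op X X) (HRI : RI Sig H) :
  H_passive Sig H /\
  (RE Sig H <->
   forall x : X,
     ereal_inf [set (dsum_norm (x, u) ^+ 2
                     - dsum_norm (system_matrix (assoc_system Sig H) (x, u)) ^+ 2)%:E
               | u in [set: U]] = 0%E).
Proof.
have pos := assoc_defect_ge0 HRI.
split; first exact: passive_defect.
split=> [[_ eqH] x|inf0].
  apply/(ereal_inf_EFin_eq0 (f := defect (assoc_system Sig H) x)) => //.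
  move: x; apply: (defect_inf_dense (sqrtH_dense_range HRI) pos) => _ [x Sx <-] e e0.
  by have [u] := assoc_defect_inf HRI Sx e0; rewrite eqH // subrr add0r; exists u.
(* Only [kyp_lhs <= kyp_rhs] remains: an input with defect below [e] at [S x] bounds the difference
   by [e], since the completed square is nonnegative. *)
split=> // x Sx; apply/eqP; rewrite eq_le RI_kyp // andbT -subr_le0.
apply/ler_addgt0Pr => e e0; rewrite add0r.
have /(_ _ e0) [u hu] := (ereal_inf_EFin_eq0 (pos (op_sqrt H x))).1 (inf0 _).
move: hu; rewrite (defect_sqrtH HRI) //.
have := exprn_ge0 2 (hnorm_ge0
  (mp_inverse (op_sqrt (delta Sig H)) (cross_op Sig H x) - op_sqrt (delta Sig H) u)).
lra.
Qed.
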